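(* Let $1<p<\infty$ and let $\psi:\mathbb{N}\to\mathbb{R}$ be finitely supported. Then $$\sum_{n=1}^{\infty}\ \sup_{m\in\mathbb{N}}\left|\min\left\{\frac1n,\frac1m\right\}\sum_{k=1}^{m}\psi(k)\right|^p\ \le\ \left(\frac{p}{p-1}\right)^p\sum_{n=1}^{\infty}|\psi(n)|^p .$$ Moreover, the constant $\left(\frac{p}{p-1}\right)^p$ is sharp: for each $1<p<\infty$, it cannot be replaced by any smaller constant such that the inequality remains valid for all finitely supported $\psi:\mathbb{N}\to\mathbb{R}$.
   Context: $\mathbb{N}=\{1,2,3,\dots\}$. A function $\psi$ on $\mathbb{N}$ is finitely supported if $\psi(n)=0$ for all but finitely many $n\in\mathbb{N}$. *)

(* Defs.v *)
From HB Require Import structures.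
From mathcomp Require Import all_boot all_order all_algebra.
From mathcomp Require Import all_classical all_reals all_analysis.

Set Implicit Arguments.
Unset Strict Implicit.
Unset Printing Implicit Defensive.

Import Order.TTheory GRing.Theory Num.Theory.

Local Open Scope classical_set_scope.
Local Open Scope ring_scope.

(* A real function on {1, 2, 3, ...} is represented by psi : nat -> R whose
   value at 0 is junk: no definition below reads it. *)

Definition finitely_supported (R : realType) (psi : nat -> R) : Prop :=
  finite_set [set n : nat | (1 <= n)%N /\ psi n != 0].

(* Infinite sums of nonnegative terms and suprema are taken in \bar R, so no
   finiteness is presupposed. *)

Definition hardy_sup_sum (R : realType) (p : R) (psi : nat -> R) : \bar R :=
  (\sum_(1 <= n <oo)
    ereal_sup [set (`| Num.min n%:R^-1 m%:R^-1 *
                       \sum_(1 <= k < m.+1) psi k | `^ p)%:E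
              | m in [set m : nat | (1 <= m)%N]])%E.

Definition power_sum (R : realType) (p : R) (psi : nat -> R) : \bar R :=
  (\sum_(1 <= n <oo) (`| psi n | `^ p)%:E)%E.

(* Main.v *)
(** Upper bound: with a = |psi|, S its partial sums and N bounding the support,
    the n-th supremum is at most F n, the maximum of S m / m for n <= m <= N.
    Elliott's proof of Hardy's inequality does not need the averages S n / n
    themselves: it works for F, because F n = S n / n at every n where F drops.
    Sharpness: psi k = k^(-1/p) for k <= N gives the harmonic sum on the right,
    and the averages alone are at least (q - eps) n^(-1/p) for large n, where
    q = p / (p - 1); let N tend to infinity. *)

Require Import Defs.
From mathcomp Require Import all_boot all_order all_algebra.
From mathcomp Require Import all_classical all_reals all_analysis.
From mathcomp Require Import ring lra.

Import Order.TTheory GRing.Theory Num.Theory.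

Local Open Scope ring_scope.

(** * Hardy's inequality for maximal averages *)

(** Young's inequality for the conjugate exponents [p / (p - 1)] and [p], cleared of
    denominators. *)
Lemma young_powR (R : realType) (p x y : R) : 1 < p -> 0 <= x -> 0 <= y ->
  p * (x `^ (p - 1) * y) <= (p - 1) * x `^ p + y `^ p.
Proof.
move=> p1 x0 y0.
have p0 : 0 < p by lra.
have p10 : 0 < p - 1 by lra.
have q0 : 0 < p / (p - 1) by rewrite divr_gt0.
have pq : (p / (p - 1))^-1 + p^-1 = 1 by field; rewrite !gt_eqF.
have := conjugate_powR (powR_ge0 x (p - 1)) y0 q0 p0 pq.
rewrite -powRrM mulrC (_ : (p - 1) * (p / (p - 1)) = p); last first.
  by field; rewrite gt_eqF.
rewrite -(ler_pM2l p0) [p * (y * _)]mulrA [p * y * _]mulrC [in p * y]mulrC.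
rewrite [_ `^ _ * (y * p)]mulrA [_ * p]mulrC => /le_trans; apply.
by rewrite le_eqVlt; apply/orP; left; apply/eqP; field; rewrite !gt_eqF.
Qed.

(* Elliott's argument bounds the sum of F n ^ p using the increments
   n * F n - (n - 1) * F (n - 1); Abel summation exchanges these for a n, since
   n * F n is the partial sum of a wherever F changes. *)
Lemma hardy_majorant (R : realType) (p : R) (a F : nat -> R) (N : nat) :
  1 < p -> (forall n, 0 <= a n) -> (forall n, 0 <= F n) -> F N.+1 = 0 ->
  (forall n, (1 <= n <= N)%N ->
     F n = F n.+1 \/ n%:R * F n = \sum_(1 <= k < n.+1) a k) ->
  \sum_(1 <= n < N.+1) F n `^ p <=
    (p / (p - 1)) `^ p * \sum_(1 <= n < N.+1) a n `^ p.
Proof.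
move=> p1 a0 F0 FN0 Fa.
have p0 : 0 < p by lra.
have p10 : 0 < p - 1 by lra.
set q := p / (p - 1).
have q0 : 0 <= q by rewrite divr_ge0// ltW.
pose u n := F n `^ (p - 1).
have uF n : F n * u n = F n `^ p by rewrite mulr_powRB1.
pose S n := \sum_(1 <= k < n.+1) a k.
(* The term with [u j.+1] is the boundary term of the Abel summation; its weight is taken one index
   ahead so that it vanishes at [j = N]. *)
have key j : (j <= N)%N ->
    (p - 1) * \sum_(1 <= n < j.+1) F n `^ p <=
    p * \sum_(1 <= n < j.+1) u n * a n +
    p * (u j.+1 * (j%:R * F j - S j)) - j%:R * F j `^ p.
  elim: j => [_|j IH jN]; first by rewrite /S !big_geq//; lra.
  have {}IH := IH (ltnW jN).
  rewrite !(big_nat_recr j.+1)//=.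
  have SS : S j.+1 = S j + a j.+1 by rewrite /S big_nat_recr.
  (* Either the two weights agree because [F] does not change, or the bracket vanishes. *)
  have Fj : u j.+1 * (j.+1%:R * F j.+1 - S j.+1) =
            u j.+2 * (j.+1%:R * F j.+1 - S j.+1).
    have [e|e] := Fa j.+1 jN; first by rewrite /u e.
    by rewrite /S e subrr !mulr0.
  (* Multiplied by [j], this bounds the cross term [p * u j.+1 * (j * F j)], the only one that does
     not cancel in the induction step. *)
  have Y := young_powR _ _ _ _ p1 (F0 j.+1) (F0 j).
  have {}Y := ler_wpM2l (ler0n R j) Y.
  move: IH Y; rewrite -/(u j.+1) -Fj SS -natr1 -!uF.
  move: (\sum_(_ <= _ < _) _) (\sum_(_ <= _ < _) _) => A B.
  nra.
have := key N (leqnn N).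
rewrite /u FN0 powR0 ?gt_eqF// mul0r mulr0 addr0 => {}key.
have NF : 0 <= N%:R * F N `^ p by rewrite mulr_ge0 ?powR_ge0.
(* Since [q * (p - 1) = p], [q] times [key] has [p] copies of the sum of [F n ^ p] on the left;
   Young absorbs [p - 1] of them and leaves the constant [q ^ p]. *)
have Y : p * \sum_(1 <= n < N.+1) u n * (q * a n) <=
    \sum_(1 <= n < N.+1) ((p - 1) * F n `^ p + (q * a n) `^ p).
  rewrite mulr_sumr; apply: ler_sum => n _; apply: young_powR => //.
  exact: mulr_ge0.
move: Y; rewrite big_split/= -mulr_sumr.
under eq_bigr do rewrite mulrCA.
rewrite -mulr_sumr.
under [X in _ <= _ + X -> _]eq_bigr do rewrite powRM//.
rewrite -mulr_sumr.
have {}key : (p - 1) * \sum_(1 <= n < N.+1) F n `^ p <=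
    p * \sum_(1 <= n < N.+1) u n * a n.
  by apply: le_trans key _; rewrite lerBlDr lerDl.
have := ler_wpM2l q0 key.
rewrite [q * ((p - 1) * _)]mulrA (_ : q * (p - 1) = p); last first.
  by rewrite /q divfK// gt_eqF.
move: (\sum_(_ <= _ < _) _) (\sum_(_ <= _ < _) _) (\sum_(_ <= _ < _) _).
move=> A B D.
lra.
Qed.

(** A maximum over [[n, N]] is either the average at [n] or the maximum over [[n + 1, N]], which is
    the dichotomy that [hardy_majorant] asks for. *)
Lemma hardy_maximal (R : realType) (p : R) (a : nat -> R) (N : nat) :
  1 < p -> (forall n, 0 <= a n) ->
  \sum_(1 <= n < N.+1)
    (\big[Num.max/0]_(n <= m < N.+1) ((\sum_(1 <= k < m.+1) a k) / m%:R)) `^ p <=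
    (p / (p - 1)) `^ p * \sum_(1 <= n < N.+1) a n `^ p.
Proof.
move=> p1 a0.
pose S m := \sum_(1 <= k < m.+1) a k.
pose F n := \big[Num.max/0]_(n <= m < N.+1) (S m / m%:R).
have F0 n : 0 <= F n by rewrite /F; apply: bigmax_ge_id.
apply: (hardy_majorant _ _ a F) => //; first by rewrite /F big_geq.
move=> n /andP[n1 nN].
rewrite {1 3}/F big_ltn// -/(F n.+1) /Order.max.
case: ifP => _; [by left|right].
by rewrite mulrC divfK// pnatr_eq0 -lt0n.
Qed.

(** * From the supremum to a finite maximum *)

(** With absolute values the partial sums increase up to [N] and stay constant afterwards, so only
    indices between [n] and [N] compete. *)
Lemma min_avg_le_bigmax (R : realType) (psi : nat -> R) (N n m : nat) :
  (forall k, (N < k)%N -> psi k = 0) -> (1 <= n <= N)%N -> (1 <= m)%N ->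
  `| Num.min n%:R^-1 m%:R^-1 * \sum_(1 <= k < m.+1) psi k | <=
  \big[Num.max/0]_(n <= j < N.+1) ((\sum_(1 <= k < j.+1) `|psi k|) / j%:R).
Proof.
move=> psi0 /andP[n1 nN] m1.
pose S m := \sum_(1 <= k < m.+1) `|psi k|.
have S0 j : 0 <= S j by exact: sumr_ge0.
have Smono i j : (i <= j)%N -> S i <= S j.
  move=> ij; rewrite /S [leRHS](big_cat_nat _ _ (n := i.+1))//= lerDl.
  exact: sumr_ge0.
have SN j : S j <= S N.
  have [/Smono//|Nj] := leqP j N.
  rewrite /S (big_cat_nat _ _ (n := N.+1))//= 1?ltnW//.
  rewrite [X in _ + X]big_nat [X in _ + X]big1 ?addr0// => k /andP[Nk _].
  by rewrite psi0// normr0.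
have leF i : (n <= i <= N)%N -> S i / i%:R <=
    \big[Num.max/0]_(n <= j < N.+1) (S j / j%:R).
  move=> /andP[ni iN].
  apply: (le_bigmax_seq 0 i predT (fun j => S j / j%:R)) => //.
  by rewrite mem_index_iota ni.
have min0 : 0 <= Num.min n%:R^-1 m%:R^-1 :> R.
  by rewrite le_min !invr_ge0 !ler0n.
rewrite normrM (ger0_norm min0).
apply: (le_trans (ler_wpM2l min0 (ler_norm_sum _ _ _))); rewrite -/(S m).
(* The index realising the bound is m moved into [n, N]. *)
have [mn|nm] := leqP m n.
  apply: le_trans (leF n _); last by rewrite leqnn.
  rewrite mulrC ler_pM//; first exact: Smono.
  by rewrite ge_min lexx.
have lem : Num.min n%:R^-1 m%:R^-1 <= m%:R^-1 :> R by rewrite ge_min lexx orbT.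
have [mN|Nm] := leqP m N.
  apply: le_trans (leF m _); last by rewrite mN ltnW.
  by rewrite mulrC ler_pM.
apply: le_trans (leF N _); last by rewrite nN leqnn.
rewrite mulrC ler_pM//; apply: le_trans lem _.
by rewrite lef_pV2 ?posrE ?ltr0n ?ler_nat ?(ltnW Nm)// (leq_trans n1).
Qed.

Lemma finitely_supported_bound (R : realType) (psi : nat -> R) :
  finitely_supported psi -> exists N, forall k, (N < k)%N -> psi k = 0.
Proof.
move=> /finite_seqP [X /seteqP [sX _]].
exists (\max_(x <- X) x)%N => k Xk; apply: contrapT => /eqP psik.
have /= kX := sX k (conj (leq_ltn_trans (leq0n _) Xk) psik).
by move: Xk; rewrite ltnNge leq_bigmax_seq.
Qed.

Lemma ereal_sup_image_ge0 (R : realType) (T : Type) (A : set T) (f : T -> R) :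
  (A !=set0)%classic -> (forall x, 0 <= f x) ->
  (0 <= ereal_sup [set (f x)%:E | x in A])%E.
Proof.
move=> [x Ax] f0; apply: le_ereal_sup_tmp; exists (f x)%:E; first by exists x.
by rewrite lee_fin.
Qed.

Lemma hardy_sup_le (R : realType) (p : R) (psi : nat -> R) :
  1 < p -> finitely_supported psi ->
  (hardy_sup_sum p psi <= ((p / (p - 1)) `^ p)%:E * power_sum p psi)%E.
Proof.
move=> p1 /finitely_supported_bound [N0 psi0].
have p0 : 0 <= p by lra.
rewrite /hardy_sup_sum; apply: lime_le.
  apply: is_cvg_nneseries => n n1 _; apply: ereal_sup_image_ge0.
    by exists 1%N.
  by move=> m; exact: powR_ge0.
(* Only late partial sums matter for the limit, so the truncation index [N] can also serve as a
   bound for the support. *)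
exists N0.+1 => // -[//|N] /= N0N.
have psiN k : (N < k)%N -> psi k = 0.
  by move=> Nk; apply: psi0; apply: leq_ltn_trans Nk.
apply: (@le_trans _ _ (((p / (p - 1)) `^ p *
    \sum_(1 <= n < N.+1) `|psi n| `^ p)%:E)); last first.
  rewrite EFinM -sumEFin lee_pmul2l ?lte_fin//; last first.
    by rewrite powR_gt0 ?divr_gt0//; lra.
  by apply: nneseries_lim_ge => n _ _; rewrite lee_fin powR_ge0.
apply: (@le_trans _ _ (\sum_(1 <= n < N.+1)
    (\big[Num.max/0]_(n <= m < N.+1)
       ((\sum_(1 <= k < m.+1) `|psi k|) / m%:R)) `^ p)%:E).
  rewrite -sumEFin big_nat [leRHS]big_nat; apply: lee_sum => n nN.
  apply: ge_ereal_sup => _ [m m1 <-]; rewrite lee_fin.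
  apply: ge0_ler_powR => //; rewrite ?nnegrE//; last exact: min_avg_le_bigmax.
  exact: bigmax_ge_id.
by rewrite lee_fin; apply: hardy_maximal.
Qed.

(** * Sharpness of the constant *)

(** The tangent bound for the concave power [s], obtained from Young's inequality with exponent
    [s^-1] at [x ^ s] and [(x + 1) ^ s]. *)
Lemma powR_succ_sub_le (R : realType) (s x : R) : 0 < s < 1 -> 0 < x ->
  (x + 1) `^ s - x `^ s <= s * x `^ (s - 1).
Proof.
move=> /andP[s0 s1] x0.
have is1 : 1 < s^-1 by rewrite invf_gt1.
have := young_powR _ _ _ _ is1 (powR_ge0 x s) (powR_ge0 (x + 1) s).
have -> : s - 1 = - (1 - s) by lra.
have -> : (x `^ s) `^ (s^-1 - 1) = x `^ (1 - s).
  by rewrite -powRrM mulrBr mulr1 divff// gt_eqF.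
rewrite -!powRrM divff ?gt_eqF// !powRr1; [|lra|lra].
rewrite powRN -(ler_pM2l s0) [s * (s^-1 * _)]mulrA divff ?gt_eqF// mul1r.
have -> : s * ((s^-1 - 1) * x + (x + 1)) = x + s by field; rewrite gt_eqF.
have xs0 : 0 < x `^ (1 - s) by rewrite powR_gt0.
rewrite -ler_pdivlMl// => /le_trans H; rewrite lerBlDr; apply: H.
rewrite mulrDr [_ * s]mulrC addrC lerD2l.
have xE : x = x `^ (1 - s) * x `^ s.
  by rewrite -powRD ?subrK ?powRr1 ?ltW// gt_eqF ?implybT.
by rewrite [X in _ * X]xE mulKf// gt_eqF.
Qed.

(** The bounds of [powR_succ_sub_le] at [x = 1, ..., n] telescope. *)
Lemma sum_powR_ge (R : realType) (s : R) (n : nat) : 0 < s < 1 ->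
  n.+1%:R `^ s - 1 <= s * \sum_(1 <= k < n.+1) k%:R `^ (s - 1).
Proof.
move=> s01; elim: n => [|n IH]; first by rewrite big_geq// powR1 subrr mulr0.
rewrite big_nat_recr//= mulrDr.
have := powR_succ_sub_le _ _ n.+1%:R s01 (ltr0Sn _ _).
rewrite natr1; lra.
Qed.

Lemma harmonic_sum_gt (R : realType) (M : R) (N0 : nat) :
  exists2 N, (N0 <= N)%N & M < \sum_(1 <= n < N.+1) n%:R^-1.
Proof.
have nd : nondecreasing_seq (series (@harmonic R)).
  by apply: nondecreasing_series => n _ _; exact: harmonic_ge0.
have /cvgryPgt/(_ M)[N1 _ h] :=
  nondecreasing_dvgn_lt nd (@dvg_harmonic R).
exists (maxn N0 N1); first exact: leq_maxl.
by rewrite big_add1; apply: h; exact: leq_maxr.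
Qed.

Lemma avg_powR_ge (R : realType) (p D : R) : 1 < p -> D < p / (p - 1) ->
  exists n0, (1 <= n0)%N /\ forall n, (n0 <= n)%N ->
    D * n%:R `^ (- p^-1) <=
    n%:R^-1 * \sum_(1 <= k < n.+1) k%:R `^ (- p^-1).
Proof.
move=> p1 Dq; pose s := 1 - p^-1.
have p0 : 0 < p by lra.
have ip1 : p^-1 < 1 by rewrite invf_lt1.
have ip0 : 0 < p^-1 by rewrite invr_gt0.
have s01 : 0 < s < 1 by rewrite /s; apply/andP; split; lra.
have s0 : 0 < s by case/andP: s01.
have sE : - p^-1 = s - 1 by rewrite /s; lra.
have Ds : 0 < 1 - D * s.
  rewrite subr_gt0 -ltr_pdivlMr// mul1r (lt_le_trans Dq)//.
  rewrite le_eqVlt; apply/orP; left; apply/eqP; rewrite /s.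
  by field; rewrite !gt_eqF//; lra.
(* As [s^-1 = p / (p - 1)], [D * s < 1]. From [t] on, [(1 - D * s) * n ^ s >= 1], which pays for the
   [- 1] in [sum_powR_ge]. *)
pose t := ((1 - D * s)^-1) `^ s^-1.
exists (Num.bound t).+1; split=> // n tn.
have n0 : (0 < n)%N by exact: leq_trans tn.
have ts : (1 - D * s)^-1 <= n%:R `^ s.
  have -> : (1 - D * s)^-1 = t `^ s.
    by rewrite /t -powRrM mulVf ?gt_eqF// powRr1// invr_ge0 ltW.
  apply: ge0_ler_powR; rewrite ?nnegrE ?powR_ge0//; first exact: ltW.
  apply: (le_trans (ltW (archi_boundP (powR_ge0 _ _)))).
  by rewrite ler_nat ltnW.
have nS := sum_powR_ge _ s n s01.
have nn : n%:R `^ s <= n.+1%:R `^ s.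
  by apply: ge0_ler_powR; rewrite ?nnegrE ?ler_nat// ltW.
rewrite sE powRB; last by rewrite pnatr_eq0 -lt0n n0 implybT.
rewrite powRr1// mulrA mulrC ler_pM2l ?invr_gt0 ?ltr0n//.
move: ts; rewrite -[(_ - _)^-1]mul1r ler_pdivrMr//.
rewrite -(ler_pM2l s0).
move: nS nn; move: (\sum_(_ <= _ < _) _) (n%:R `^ s) (n.+1%:R `^ s) => A B E.
lra.
Qed.

(** If [C < D ^ p] with [D < p / (p - 1)], the test functions make [D ^ p - C] times the harmonic
    sum at most a constant independent of [N], against divergence. *)
Lemma hardy_constant_ge (R : realType) (p C : R) : 1 < p ->
  (forall psi : nat -> R, finitely_supported psi ->
     (hardy_sup_sum p psi <= C%:E * power_sum p psi)%E) ->
  (p / (p - 1)) `^ p <= C.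
Proof.
move=> p1 H; rewrite leNgt; apply/negP => Cq.
have p0 : 0 < p by lra.
have q0 : 0 < p / (p - 1) by rewrite divr_gt0//; lra.
(* [D] is the [p]-th root of a midpoint; the maximum with 0 covers negative [C]. *)
have [D /andP[D0 Dq] CD] : exists2 D : R, 0 <= D < p / (p - 1) & C < D `^ p.
  pose M := (Num.max C 0 + (p / (p - 1)) `^ p) / 2.
  have M0 : 0 <= Num.max C 0 < (p / (p - 1)) `^ p.
    by rewrite le_max lexx orbT gt_max Cq powR_gt0.
  have CM : C <= Num.max C 0 by rewrite le_max lexx.
  have M1 : 0 <= M by rewrite /M; lra.
  exists (M `^ p^-1); last by rewrite -powRrM mulVf ?gt_eqF// powRr1// /M; lra.
  rewrite powR_ge0/=.
  have -> : p / (p - 1) = ((p / (p - 1)) `^ p) `^ p^-1.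
    by rewrite -powRrM mulfV ?gt_eqF// powRr1// ltW.
  apply: gt0_ltr_powR; rewrite ?invr_gt0 ?nnegrE ?powR_ge0//.
  by rewrite /M; lra.
have [n0 [n01 avg]] := avg_powR_ge _ _ _ p1 Dq.
(* [K] is the share of the indices below [n0], where [avg] says nothing. *)
pose K := \sum_(1 <= n < n0) D `^ p * n%:R^-1.
have [N n0N] := harmonic_sum_gt _ (K / (D `^ p - C)) n0.
rewrite ltr_pdivrMr ?subr_gt0// ltNge => /negP; apply.
pose psi k : R := if (k <= N)%N then k%:R `^ (- p^-1) else 0.
have psi_fin : finitely_supported psi.
  apply: (@sub_finite_set _ _ `I_N.+1); last exact: finite_II.
  by move=> k [_]; rewrite /psi /= ltnS; case: ifP => // _; rewrite eqxx.
have pow1 n : (n%:R `^ (- p^-1)) `^ p = n%:R^-1 :> R.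
  by rewrite -powRrM mulNr mulVf ?gt_eqF// powR_inv1.
have powN : power_sum p psi = (\sum_(1 <= n < N.+1) n%:R^-1)%:E.
  rewrite /power_sum (nneseries_split _ N); last first.
    by move=> n _; rewrite lee_fin powR_ge0.
  rewrite add1n eseries0; last first.
    move=> n Nn _; rewrite /psi leqNgt Nn/= normr0 powR0//.
    by rewrite gt_eqF.
  rewrite adde0 sumEFin; congr (_%:E); apply: eq_big_nat => n /andP[_ nN].
  by rewrite /psi -ltnS nN ger0_norm ?powR_ge0.
have := H psi psi_fin; rewrite powN -EFinM => HC.
have sup_ge : ((\sum_(n0 <= n < N.+1) D `^ p * n%:R^-1)%:E <=
    hardy_sup_sum p psi)%E.
  apply: (@le_trans _ _ (\sum_(1 <= n < N.+1) ereal_sup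
     [set (`|Num.min n%:R^-1 m%:R^-1 * \sum_(1 <= k < m.+1) psi k| `^ p)%:E
       | m in [set m : nat | (1 <= m)%N]])%E); last first.
    apply: nneseries_lim_ge => n n1 _.
    apply: ereal_sup_image_ge0; first by exists 1%N.
    by move=> m; exact: powR_ge0.
  rewrite [leRHS](big_cat_nat _ _ (n := n0))//=; last exact: leqW.
  rewrite -sumEFin -[leLHS]add0e; apply: leeD.
    rewrite big_nat; apply: sume_ge0 => n /andP[n1 _].
    apply: ereal_sup_image_ge0; first by exists 1%N.
    by move=> m; exact: powR_ge0.
  rewrite [leLHS]big_nat [leRHS]big_nat; apply: lee_sum => n /andP[n0n nN].
  (* The choice [m = n] in the supremum gives the plain average. *)
  apply: le_ereal_sup_tmp.
  eexists; first by exists n => //; exact: leq_trans n01 n0n.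
  rewrite minxx lee_fin.
  rewrite (eq_big_nat _ _ (F2 := fun k => k%:R `^ (- p^-1))); last first.
    move=> k /andP[_ kn]; rewrite /psi (leq_trans _ (_ : (n <= N)%N))//.
  have An := avg n n0n.
  rewrite -[in leLHS]pow1 -powRM ?powR_ge0//.
  have Dn : 0 <= D * n%:R `^ (- p^-1) by rewrite mulr_ge0 ?powR_ge0.
  rewrite ger0_norm; last exact: le_trans Dn An.
  apply: ge0_ler_powR => //; [exact: ltW|rewrite nnegrE; exact: le_trans Dn An].
have := le_trans sup_ge HC; rewrite lee_fin => {}HC.
rewrite mulrC mulrBl lerBlDr [leLHS]mulr_sumr.
rewrite [leLHS](big_cat_nat _ _ (n := n0))//=; last exact: leqW.
by rewrite lerD2l.
Qed.

Theorem theorem3p1 (R : realType) (p : R) (hp : 1 < p) :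
  (forall psi : nat -> R, finitely_supported psi ->
     (hardy_sup_sum p psi <= ((p / (p - 1)) `^ p)%:E * power_sum p psi)%E) /\
  (forall C : R, C < (p / (p - 1)) `^ p ->
     ~ (forall psi : nat -> R, finitely_supported psi ->
          (hardy_sup_sum p psi <= C%:E * power_sum p psi)%E)).
Proof.
split=> [psi|C Cq H]; first exact: hardy_sup_le.
by move: (hardy_constant_ge _ _ _ hp H); rewrite leNgt Cq.
Qed.
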